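(* Let $\gamma=\frac{2+\log_5 2}{3}=0.8102\dots$. There is an absolute constant $c>0$ such that for every positive integer $N$ there exists a set $A\subseteq[N]$ such that no non-zero difference $a-a'$ with $a,a'\in A$ lies in the set $\{x^2+5x^3: x\in\mathbb{Z}\}$, and $|A|\geq cN^{\gamma}$.
   Context: $[N]=\{1,2,\dots,N\}$. *)

(* Defs.v *)
From HB Require Import structures.
From mathcomp Require Import all_boot all_order all_algebra.
From mathcomp Require Import finmap.
From mathcomp Require Import all_classical all_reals all_analysis.

Set Implicit Arguments.
Unset Strict Implicit.
Unset Printing Implicit Defensive.

Import Order.TTheory GRing.Theory Num.Theory.
Local Open Scope classical_set_scope.
Local Open Scope ring_scope.

Definition logb {R : realType} (b x : R) : R := ln x / ln b.

Definition gamma {R : realType} : R := (2 + logb 5 2) / 3.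

Definition poly_values : set int := range (fun x : int => x ^+ 2 + 5 * x ^+ 3).

(* Main.v *)
(** Base-5 digits, as in Ruzsa's construction for squares.  Write
    [x^2 + 5 x^3 = x^2 (1 + 5 x)] with [x = 5^v y] and [5] not dividing [y]: its
    lowest nonzero base-5 digit sits at the even position [2 v] and is a square
    modulo 5, that is [1] or [4].  If the digits of the elements of [A] at even
    positions are restricted to [{0, 2}], then a difference whose lowest nonzero
    digit sits at such a position has the digit [2] or [3] there.  Because the
    polynomial is cubic, values below [125^k] have [v < k], so only the even
    positions below [2 k] out of the [3 k] available ones have to be restricted.
    This leaves [10^k * 5^k = 50^k] elements below [125^k]. *)
Require Import Defs.
From HB Require Import structures.
From mathcomp Require Import all_boot all_order all_algebra.
From mathcomp Require Import finmap.
From mathcomp Require Import all_classical all_reals all_analysis.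
From mathcomp Require Import zify ring.

Set Implicit Arguments.
Unset Strict Implicit.
Unset Printing Implicit Defensive.

Import Order.TTheory GRing.Theory Num.Theory.
Local Open Scope classical_set_scope.
Local Open Scope ring_scope.

(** One base-25 digit packs an even and an odd base-5 position: the low base-5 digit is 0 or 2, the
    high one is free. *)
Definition digits25 : seq nat := [:: 0; 2; 5; 7; 10; 12; 15; 17; 20; 22]%N.

Fixpoint restricted (k : nat) : seq nat :=
  if k is k'.+1
  then [seq (d + 25 * s)%N | d <- digits25, s <- restricted k']
  else [:: 0%N].

(** The factor [25 ^ k * t] supplies the top [k] base-5 digits, all unrestricted. *)
Definition digit_set (k : nat) : seq nat :=
  [seq (s + 25 ^ k * t)%N | s <- restricted k, t <- iota 0 (5 ^ k)].

Lemma digits25P (d : nat) :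
  d \in digits25 -> (d < 25)%N /\ (d %% 5 = 0 \/ d %% 5 = 2)%N.
Proof.
by rewrite !inE => /or4P[|||/or4P[|||/or4P[]]] /eqP->; split=> //; auto.
Qed.

Lemma addn_mul_inj (m a a' b b' : nat) :
  (a < m)%N -> (a' < m)%N -> (a + m * b = a' + m * b')%N -> a = a' /\ b = b'.
Proof.
move=> am am' e; have m0 : (0 < m)%N by lia.
have := congr1 (modn^~ m) e; have := congr1 (divn^~ m) e => /=.
by rewrite ![(m * _)%N]mulnC !(addnC _ (_ * m)%N) !divnMDl // !modnMDl
  !divn_small // !modn_small // !addn0.
Qed.

Lemma uniq_allpairs_addn_mul (m : nat) (s t : seq nat) :
  {in s, forall a, (a < m)%N} -> uniq s -> uniq t ->
  uniq [seq (a + m * b)%N | a <- s, b <- t].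
Proof.
move=> sm us ut; apply: allpairs_uniq => //.
move=> _ _ /allpairsP[[a b] [/= sa _ ->]]
  /allpairsP[[a' b'] [/= sa' _ ->]] /= e.
by have [-> ->] := addn_mul_inj (sm _ sa) (sm _ sa') e.
Qed.

Lemma restrictedSP (k s : nat) : s \in restricted k.+1 ->
  exists d r : nat, [/\ (d < 25)%N, (d %% 5 = 0 \/ d %% 5 = 2)%N,
    r \in restricted k & s = (d + 25 * r)%N].
Proof. by case/allpairsP=> -[d r] [/digits25P[d25 d5] rk ->]; exists d, r. Qed.

Lemma restricted_lt (k s : nat) : s \in restricted k -> (s < 25 ^ k)%N.
Proof.
elim: k s => [|k IH] s; first by rewrite inE => /eqP->.
by case/restrictedSP=> d [r] [d25 _ /IH + ->]; rewrite expnS; lia.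
Qed.

Lemma uniq_restricted (k : nat) : uniq (restricted k).
Proof.
elim: k => // k IH; apply: uniq_allpairs_addn_mul => // d.
by case/digits25P.
Qed.

Lemma size_restricted (k : nat) : size (restricted k) = (10 ^ k)%N.
Proof. by elim: k => // k IH; rewrite size_allpairs IH expnS. Qed.

Lemma digit_set_lt (k a : nat) : a \in digit_set k -> (a < 125 ^ k)%N.
Proof.
case/allpairsP=> -[s t] [/restricted_lt /= s25]; rewrite mem_iota => t5 ->.
by rewrite (_ : 125 = 25 * 5)%N // expnMn; nia.
Qed.

Lemma uniq_digit_set (k : nat) : uniq (digit_set k).
Proof.
apply: uniq_allpairs_addn_mul; first exact: restricted_lt.
  exact: uniq_restricted.
exact: iota_uniq.
Qed.

Lemma size_digit_set (k : nat) : size (digit_set k) = (50 ^ k)%N.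
Proof. by rewrite size_allpairs size_restricted size_iota -expnMn. Qed.

(* The factor [1 + 5 * z] is decoupled from [x] so that the induction may divide
   [x] by 5. *)
Lemma restricted_diff (k s s' : nat) (t x z : int) :
  s \in restricted k -> s' \in restricted k ->
  s%:Z - s'%:Z + 25 ^+ k * t = x ^+ 2 * (1 + 5 * z) ->
  s = s' /\ exists y : int, x = 5 ^+ k * y.
Proof.
elim: k s s' t x => [|k IH] s s' t x.
  rewrite !inE => /eqP-> /eqP-> _; split=> //; exists x; ring.
case/restrictedSP=> d [r] [d25 d5 rk ->].
case/restrictedSP=> d' [r'] [d25' d5' rk' ->] e.
have eD : d%:Z - d'%:Z
    = x ^+ 2 * (1 + 5 * z) - 25 * (r%:Z - r'%:Z + 25 ^+ k * t).
  by rewrite -e exprS; ring.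
(* Modulo 5 the equation reads [d - d' = x ^+ 2]. The left side is 0, 2 or 3 and squares are 0, 1 or
   4, so both sides vanish. *)
have [y xE] : exists y : int, x = 5 * y.
  pose q := (x %/ 5)%Z; pose m := (x %% 5)%Z.
  have xE : x = q * 5 + m by exact: divz_eq.
  have [m0 m5] : 0 <= m /\ m < 5 by rewrite /m; lia.
  have eE : d%:Z - d'%:Z - m ^+ 2 = 5 * (x ^+ 2 * z + 5 * q ^+ 2 + 2 * q * m
     - 5 * (r%:Z - r'%:Z + 25 ^+ k * t)).
    by rewrite eD mulrDr mulr1 {1}xE; ring.
  exists q; rewrite xE.
  suff -> : m = 0 by ring.
  move: eE; set w := (X in 5 * X) => eE.
  have : m = 0 \/ m = 1 \/ m = 2 \/ m = 3 \/ m = 4 by lia.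
  by case=> [//|[|[|[]]]] mE; move: eE; rewrite mE; lia.
have e' : d%:Z - d'%:Z
    = 25 * (y ^+ 2 * (1 + 5 * z) - (r%:Z - r'%:Z + 25 ^+ k * t)).
  by rewrite eD xE; ring.
move: e'; set w := (X in 25 * X) => e'.
(* A multiple of 25 that is a difference of two numbers below 25 is zero; [w = 0] is then the same
   equation for [k] and [y]. *)
have [dd w0] : d = d' /\ w = 0 by lia.
have [-> [v yE]] : r = r' /\ exists v : int, y = 5 ^+ k * v.
  by apply: (IH _ _ t y) => //; move/eqP: w0; rewrite subr_eq0 => /eqP.
by rewrite dd; split=> //; exists v; rewrite xE yE exprS mulrA.
Qed.

Lemma digit_set_diff (k a a' : nat) (x : int) :
  a \in digit_set k -> a' \in digit_set k ->
  a%:Z - a'%:Z = x ^+ 2 + 5 * x ^+ 3 -> a = a'.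
Proof.
move=> Aa Aa' e; have := digit_set_lt Aa; have := digit_set_lt Aa'.
move: Aa Aa' e; case/allpairsP=> -[s t] [/= sk _ ->].
case/allpairsP=> -[s' t'] [/= sk' _ ->] e lt' lt.
have [ss [y xE]] : s = s' /\ exists y : int, x = 5 ^+ k * y.
  apply: (@restricted_diff k s s' (t%:Z - t'%:Z) x x) => //.
  have -> : x ^+ 2 * (1 + 5 * x) = x ^+ 2 + 5 * x ^+ 3 by ring.
  have -> : 25 ^+ k = (25 ^ k)%N%:Z by rewrite -[RHS]natz natrX.
  rewrite -e; ring.
(* Size argument: if [y] is nonzero, then [5 ^+ k <= |x| <= |1 + 5 * x|], so the value has modulus
   at least [125 ^ k], too large for a difference of two elements. *)
have y0 : y = 0.
  apply/eqP; apply: contraT => y0.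
  set p : int := 5 ^+ k.
  have p0 : 1 <= p by rewrite /p exprn_ege1.
  have pE : (125 ^ k)%N%:Z = p ^+ 3.
    by rewrite -[LHS]natz natrX /p -exprM mulnC exprM -natrX.
  have ub : `|x ^+ 2 + 5 * x ^+ 3| < p ^+ 3 by rewrite -e -pE; lia.
  have px : p <= `|x| by rewrite xE normrM; nia.
  have lb : p ^+ 3 <= `|x ^+ 2 + 5 * x ^+ 3|.
    have -> : x ^+ 2 + 5 * x ^+ 3 = x ^+ 2 * (1 + 5 * x) by ring.
    rewrite normrM normrX exprSr; apply: ler_pM; try lia.
    by apply: lerXn2r => //; rewrite nnegrE; lia.
  lia.
move: e; rewrite xE y0 mulr0 !expr0n /= mulr0 addr0 => /eqP.
by rewrite subr_eq0 => /eqP[].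
Qed.

(** Since 125 is the cube of 5, raising it to [gamma] gives 5 to the power [2 + logb 5 2], that is
    25 * 2. *)
Lemma powR125_gamma (R : realType) (k : nat) :
  ((125 ^ k)%N%:R : R) `^ gamma = (50 ^ k)%N%:R.
Proof.
have ln5 : ln (5 : R) != 0 by rewrite gt_eqF // ln_gt0 // ltr1n.
have base : (125 : R) `^ gamma = 50.
  have -> : (125 : R) = 5 ^+ 3 by rewrite -natrX.
  rewrite -powR_mulrn // -powRrM /gamma.
  have -> : 3 * ((2 + logb 5 2) / 3) = 2 + logb 5 2 :> R by field.
  rewrite powRD; last by rewrite pnatr_eq0 implybT.
  rewrite powR_mulrn // /powR pnatr_eq0 /= /logb divfK // lnK ?posrE //.
  by rewrite -natrX -natrM.
rewrite !natrX -powR_mulrn // -powRrM mulrC powRrM base powR_mulrn //.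
Qed.

Theorem theorem1p2 (R : realType) :
  exists c : R, 0 < c /\
    forall N : nat, (0 < N)%N ->
      exists A : {fset int},
        [/\ forall a : int, a \in A -> 1 <= a <= N%:Z,
            forall a a' : int, a \in A -> a' \in A -> a - a' != 0 ->
              ~ poly_values (a - a')
          & c * (N%:R `^ gamma) <= (#|` A|)%:R].
Proof.
(* The loss of 50 comes from rounding [N] down to a power of 125: [N < 125 ^ k.+1] gives
   [N ^ gamma <= 50 ^ k.+1]. *)
exists 50^-1; split=> [|N N0]; first by rewrite invr_gt0.
pose k := trunc_log 125 N.
have /andP[kN Nk] := trunc_log_bounds (isT : (1 < 125)%N) N0.
(* The shift by one moves the set from [[0, 125 ^ k)] into [[1, N]] and keeps differences. *)
exists [fset (Posz a.+1) | a in digit_set k]%fset; split.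
- by move=> _ /imfsetP[a /= /digit_set_lt ak ->]; rewrite -/k in kN; lia.
- move=> _ _ /imfsetP[a /= ak ->] /imfsetP[a' /= ak' ->] aa' [x _ xE].
  have e : a = a' by apply: (digit_set_diff (x := x) ak ak'); rewrite xE; lia.
  by rewrite e subrr eqxx in aa'.
- rewrite card_imfset /=; last by move=> a b [].
  rewrite undup_id ?uniq_digit_set // size_digit_set.
  rewrite mulrC ler_pdivrMr // -natrM -expnSr -powR125_gamma.
  apply: ge0_ler_powR; rewrite ?nnegrE // ?ler_nat ?(ltnW Nk) //.
  rewrite /gamma /logb divr_ge0 // addr_ge0 // divr_ge0 // ln_ge0 // ler1n //.
Qed.
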